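(* Consider mechanisms that use only quantile information about the seller's distribution: such a mechanism is a probability distribution $G$ on $[0,1]$ (fixed independently of $F_S,F_B$); it draws $u\sim G$ and posts the price $p=F_S^{-1}(u)$. For every such $G$, \[\inf_{F_S,F_B\in\Delta_{L^1}(\mathbb{R}_+)}\frac{\mathsf{W}(G;F_S,F_B)}{\mathsf{OPT\text{-}W}(F_S,F_B)}\ \le\ 1-\frac1e .\] That is, no (possibly randomized) mechanism using only quantile knowledge of the seller's distribution guarantees more than a $(1-1/e)$ fraction of the optimal welfare.
   Context: Asymmetric bilateral trade: $S\sim F_S$, $B\sim F_B$ independent, distributions on $[0,\infty)$ with finite mean. Posting price $p$, trade iff $B>p\ge S$; $\mathsf{W}(p;F_S,F_B)=\mathbb{E}[S+(B-S)\mathbf 1_{B>p\ge S}]$ and $\mathsf{OPT\text{-}W}(F_S,F_B)=\mathbb{E}[\max\{B,S\}]$. $F_S^{-1}(u)=\inf\{x:F_S(x)\ge u\}$ is the quantile function, and $\mathsf{W}(G;F_S,F_B)=\mathbb{E}_{u\sim G}[\mathsf{W}(F_S^{-1}(u);F_S,F_B)]$. *)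

(* Defs.v *)
From HB Require Import structures.
From mathcomp Require Import all_boot all_order all_algebra.
From mathcomp Require Import all_classical all_reals all_analysis.
Set Implicit Arguments. Unset Strict Implicit. Unset Printing Implicit Defensive.
Import Order.TTheory GRing.Theory Num.Theory.
Local Open Scope classical_set_scope.
Local Open Scope ring_scope.
Local Open Scope ereal_scope.

Section bilateral.
Variable R : realType.

Definition nonneg_L1 (F : probability R R) : Prop :=
  F `]-oo, 0%R[%classic = 0 /\ F.-integrable setT (fun x : R => x%:E).

(* CDF and quantile F^{-1}(u) = inf {x >= 0 : F(x) >= u}, valued in \bar R
   (+oo when the set is empty). *)
Definition cdf (F : probability R R) (x : R) : \bar R := F `]-oo, x%R]%classic.

Definition quantile (F : probability R R) (u : R) : \bar R :=
  ereal_inf [set x%:E | x in [set x : R | (0 <= x)%R /\ u%:E <= cdf F x]].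

Definition trade (p : \bar R) (s b : R) : bool := (p < b%:E) && (s%:E <= p).

Definition W (FS FB : probability R R) (p : \bar R) : \bar R :=
  \int[FS \x FB]_z
     (z.1 + (z.2 - z.1) * (if trade p z.1 z.2 then 1 else 0))%R%:E.

Definition OPTW (FS FB : probability R R) : \bar R :=
  \int[FS \x FB]_z (Num.max z.2 z.1)%:E.

Definition WG (G FS FB : probability R R) : \bar R :=
  \int[G]_u W FS FB (quantile FS u).

End bilateral.

(* Main.v *)
Require Import Defs.
From HB Require Import structures.
From mathcomp Require Import all_boot all_order all_algebra.
From mathcomp Require Import all_classical all_reals all_analysis.
From mathcomp Require Import measurable_realfun.
From mathcomp Require Import ring lra.
Import Order.TTheory GRing.Theory Num.Theory.
Local Open Scope classical_set_scope.
Local Open Scope ring_scope.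
Local Open Scope ereal_scope.

(* Take a buyer of value 1 and a seller whose value is almost 0 with probability
   x and 1 otherwise, with a quantile function strictly increasing below x. The
   optimal welfare is at least 1. Posting the quantile u makes the seller trade
   with probability u when u <= x, and no trade happens when u > x; up to an
   arbitrarily small d, the mechanism G therefore obtains
   1 - x + \int_(0 < u <= x) u dG. If this exceeded 1 - c for every x, then
   averaging over x_k = exp(- k h), k <= n, with weights 1/x_k - 1/x_(k-1)
   (and 1 for k = 0) would give n (1 - exp(- h)) <= G(]0, 1]) <= 1, where
   c = exp(- n h); this fails for n large whenever n h > 1, i.e. c < 1/e. *)

(** * Integrals against Dirac and image measures *)

(* Unlike in [ge0_le_integral], f and g need not be measurable, which spares a
   proof that u |-> W FS FB (quantile FS u) is. *)
Lemma le_integral_ge0r (d : measure_display) (T : measurableType d)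
    (R : realType) (mu : {measure set T -> \bar R}) (f g : T -> \bar R) :
  (forall x, f x <= g x) -> (forall x, 0 <= g x) ->
  \int[mu]_x f x <= \int[mu]_x g x.
Proof.
move=> fg g0; rewrite integralE.
apply: (@le_trans _ _ (\int[mu]_x f^\+ x)).
  by apply: geeDl; rewrite oppe_le0; apply: integral_ge0.
rewrite !ge0_integralTE//; apply: ereal_sup_le => _ [h /= hf <-].
exists h => // x; apply: le_trans (hf x) _.
by rewrite funeposE ge_max fg g0.
Qed.

(** Tonelli is applied to the positive and negative parts separately, since the welfare integrand is
    signed on R * R. *)
Lemma integral_prod_dirac (d1 d2 : measure_display) (T1 : measurableType d1)
    (T2 : measurableType d2) (R : realType) (m : probability T1 R) (b : T2)
    (f : T1 * T2 -> \bar R) :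
  measurable_fun setT f ->
  \int[m \x (dirac b : probability T2 R)]_z f z = \int[m]_s f (s, b).
Proof.
move=> mf.
have tonelli (g : T1 * T2 -> \bar R) : measurable_fun setT g -> (forall z, 0 <= g z) ->
    \int[m \x (dirac b : probability T2 R)]_z g z = \int[m]_s g (s, b).
  move=> mg g0; rewrite fubini_tonelli1//; apply: eq_integral => s _.
  rewrite /fubini_F integral_dirac//= ?diracT ?mul1e//.
  exact: measurableT_comp.
rewrite integralE [RHS]integralE.
congr (_ - _); rewrite tonelli//.
- by apply: eq_integral => s _; rewrite !funeposE.
- exact: measurable_funepos.
- by apply: eq_integral => s _; rewrite !funenegE.
- exact: measurable_funeneg.
Qed.

Lemma integral_distribution_measurable (d d' : measure_display) (T : measurableType d)
    (T' : measurableType d') (R : realType) (P : probability T R)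
    (X : {mfun T >-> T'}) (f : T' -> \bar R) :
  measurable_fun setT f ->
  \int[distribution P X]_y f y = \int[P]_t f (X t).
Proof.
move=> mf; rewrite integralE [RHS]integralE.
have XE (g : T' -> \bar R) : measurable_fun setT g -> (forall y, 0 <= g y) ->
    \int[distribution P X]_y g y = \int[P]_t g (X t).
  by move=> mg g0; rewrite ge0_integral_pushforward.
congr (_ - _); rewrite XE//.
- by apply: eq_integral => t _; rewrite !funeposE.
- exact: measurable_funepos.
- by apply: eq_integral => t _; rewrite !funenegE.
- exact: measurable_funeneg.
Qed.

Lemma measurable_welfare (R : realType) (p : \bar R) :
  measurable_fun setT (fun z : R * R =>
     (z.1 + (z.2 - z.1) * (if trade p z.1 z.2 then 1 else 0))%R%:E).
Proof.
apply/measurable_EFinP.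
apply: measurable_funD => //; apply: measurable_funM; first exact: measurable_funB.
apply: measurable_fun_ifT => //; rewrite /trade; apply: measurable_and.
  apply: measurable_fun_lte => //; exact/measurable_EFinP.
apply: measurable_fun_lee => //; exact/measurable_EFinP.
Qed.

(** * Averaging over geometric thresholds *)

(* Probability of trade when the quantile u of the seller below is posted. *)
Definition useful_quantile {R : realType} (x u : R) : R :=
  (if 0 < u <= x then u else 0)%R.

(* 1/x_k - 1/x_(k-1), where x_k = exp(- k h). *)
Definition weight {R : realType} (h : R) (k : nat) : R :=
  (if k is k'.+1 then expR (k%:R * h) - expR (k'%:R * h) else 1)%R.

Lemma useful_quantile_ge0 {R : realType} (x u : R) :
  (0 <= useful_quantile x u)%R.
Proof. by rewrite /useful_quantile; case: ifP => // /andP[/ltW]. Qed.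

Lemma measurable_useful_quantile {R : realType} (x : R) :
  measurable_fun setT (useful_quantile x).
Proof.
apply: measurable_fun_ifT => //.
by apply: measurable_and; apply: measurable_fun_ltr || apply: measurable_fun_ler.
Qed.

Lemma weight_ge0 {R : realType} (h : R) (k : nat) :
  (0 <= h)%R -> (0 <= weight h k)%R.
Proof.
move=> h0; case: k => [|k] //=.
by rewrite subr_ge0 ler_expR ler_wpM2r// ler_nat.
Qed.

Lemma sum_weight_le {R : realType} (h u : R) (n : nat) : (0 <= h)%R ->
  (\sum_(k < n.+1) weight h k * useful_quantile (expR (- (k%:R * h))) u <= 1)%R.
Proof.
move=> h0; have [u0|u0] := lerP u 0.
  rewrite big1 ?ler01// => k _.
  by rewrite /useful_quantile ltNge u0/= mulr0.
(* The second bound makes the induction work: when u <= x_(n+1), the new term u (exp((n+1) h) -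
   exp(n h)) raises it to u / x_(n+1), which is at most 1. *)
suff [S1 _] : (\sum_(k < n.+1) weight h k * useful_quantile (expR (- (k%:R * h))) u
    <= 1 /\ \sum_(k < n.+1) weight h k * useful_quantile (expR (- (k%:R * h))) u
    <= u * expR (n%:R * h))%R by [].
(* The terms with u <= x_k telescope to u / x_m, where x_m is the least such x_k. *)
elim: n => [|n [IH1 IH2]].
  rewrite big_ord_recl big_ord0 /= !mul0r oppr0 expR0 mul1r addr0 mulr1.
  by rewrite /useful_quantile u0/=; case: ifP => //; split => //; rewrite ltW.
rewrite big_ord_recr/=.
have mono : (expR (n%:R * h) <= expR (n.+1%:R * h))%R.
  by rewrite ler_expR ler_wpM2r// ler_nat.
rewrite {2 4}/useful_quantile u0/=; case: ifP => [ux|_]; last first.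
  by rewrite mulr0 addr0; split=> //; apply: le_trans IH2 _; rewrite ler_wpM2l// ltW.
have Suy : (u * expR (n.+1%:R * h) <= 1)%R.
  by rewrite -ler_pdivlMr ?expR_gt0// mul1r -expRN.
split; nra.
Qed.

(** The weights telescope to exp(n h), while weight times x_k is 1 for k = 0 and 1 - exp(- h) for
    every later k. *)
Lemma sum_weight_threshold {R : realType} (h c : R) (n : nat) :
  (\sum_(k < n.+1) weight h k * (expR (- (k%:R * h)) - c) =
   1 + n%:R * (1 - expR (- h)) - c * expR (n%:R * h))%R.
Proof.
elim: n => [|n IH].
  by rewrite big_ord_recl big_ord0 /= !mul0r oppr0 expR0; ring.
rewrite big_ord_recr /= IH.
have E1 : (expR (n.+1%:R * h) * expR (- (n.+1%:R * h)) = 1)%R.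
  by rewrite -expRD subrr expR0.
have E2 : (expR (n%:R * h) * expR (- (n.+1%:R * h)) = expR (- h))%R.
  by rewrite -expRD; congr expR; rewrite -natr1; ring.
rewrite [X in (_ + X)%R](_ : _ = 1 - expR (- h) -
  c * (expR (n.+1%:R * h) - expR (n%:R * h)))%R; last first.
  move: E1 E2; move: (expR (n.+1%:R * h)) (expR (n%:R * h)) => a b.
  by move: (expR (- (n.+1%:R * h))) (expR (- h)) => e f; nra.
by rewrite -[X in (_ = 1 + X * _ - _)%R]natr1; ring.
Qed.

Lemma exists_low_threshold {R : realType} (G : probability R R) (L : R) :
  (1 < L)%R ->
  exists x : R, [/\ (0 < x)%R, (x <= 1)%R &
    \int[G]_u (useful_quantile x u)%:E <= (x - expR (- L))%:E].
Proof.
move=> L1.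
(* With h = L / n, this is exactly the condition n h / (1 + h) > 1 that gives the final
   contradiction. *)
have [n nL] : exists n : nat, (L < n%:R * (L - 1))%R.
  exists (Num.bound (L / (L - 1))).
  rewrite -ltr_pdivrMr ?subr_gt0// archi_boundP// divr_ge0// ltW// ?subr_gt0//.
  exact: lt_trans ltr01 L1.
have n0 : (0 < n%:R :> R)%R.
  by rewrite ltr0n lt0n; apply/negP => /eqP n0; rewrite n0 in nL; nra.
pose h := (L / n%:R)%R.
have h0 : (0 < h)%R by rewrite divr_gt0//; lra.
pose y k := expR (- (k%:R * h)).
have y1 k : (y k <= 1)%R.
  by rewrite -expR0 ler_expR oppr_le0 mulr_ge0// ltW.
have nh : (n%:R * h = L)%R by rewrite /h mulrC divfK// gt_eqF.
apply: contrapT => noth.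
have big k : (y k - expR (- L))%:E <= \int[G]_u (useful_quantile (y k) u)%:E.
  rewrite leNgt; apply/negP => lt.
  by case: noth; exists (y k); split; [exact: expR_gt0|exact: y1|exact: ltW].
have sum_le1 : \sum_(k < n.+1) (weight h k)%:E *
    \int[G]_u (useful_quantile (y k) u)%:E <= 1.
  under eq_bigr => k _.
    rewrite -ge0_integralZl_EFin//; last 3 first.
      by move=> u _; rewrite lee_fin useful_quantile_ge0.
      by apply/measurable_EFinP; exact: measurable_useful_quantile.
      exact/weight_ge0/ltW.
    over.
  rewrite -ge0_integral_sum//; last 2 first.
    move=> k; apply/measurable_EFinP/measurable_funM => //.
    exact: measurable_useful_quantile.
    by move=> k u _; rewrite lee_fin mulr_ge0 ?useful_quantile_ge0// weight_ge0// ltW.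
  apply: (@le_trans _ _ (\int[G]_u cst 1 u)); last first.
    rewrite integral_cst// mul1e; exact: probability_le1.
  apply: le_integral_ge0r => // u /=.
  by rewrite sumEFin lee_fin sum_weight_le// ltW.
have : \sum_(k < n.+1) (weight h k * (y k - expR (- L)))%:E <= 1.
  apply: le_trans sum_le1; apply: lee_sum => k _.
  by rewrite EFinM lee_wpmul2l// lee_fin weight_ge0// ltW.
(* As n h = L, the term exp(- L) exp(n h) cancels the 1 from k = 0, leaving n (1 - exp(- h)) <=
   1. *)
rewrite sumEFin lee_fin /y sum_weight_threshold nh -expRD addNr expR0.
have eh : (expR (- h) * (1 + h) <= 1)%R.
  by rewrite expRN mulrC ler_pdivrMr ?expR_gt0// mul1r expR_ge1Dx.
suff : (1 < n%:R * (1 - expR (- h)))%R by lra.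
have : (h / (1 + h) <= 1 - expR (- h))%R.
  by rewrite ler_pdivrMr; nra.
move=> /(ler_wpM2l (ltW n0)); apply: lt_le_trans.
by rewrite mulrA nh ltr_pdivlMr; [rewrite mul1r|]; nra.
Qed.

(** * The seller's distribution and its quantiles *)

(* With the value d * t rather than 0 below x, the seller's distribution has no
   atom there: a price p = d * u attracts only the quantiles t <= u. *)
Definition seller_quantile {R : realType} (x d t : R) : R :=
  (if t <= x then d * Num.max t 0 else 1)%R.

Lemma measurable_seller_quantile {R : realType} (x d : R) :
  measurable_fun setT (seller_quantile x d).
Proof.
apply: measurable_fun_ifT => //; first exact: measurable_fun_ler.
by apply: measurable_funM => //; apply: measurable_maxr.
Qed.

Lemma seller_quantile_itv {R : realType} (x d t : R) :
  (0 < d)%R -> (d < 1)%R -> (x <= 1)%R -> (0 <= seller_quantile x d t <= 1)%R.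
Proof.
move=> d0 d1 x1; rewrite /seller_quantile; case: ifP => [tx|_].
  have [t0|t0] := lerP t 0; first by rewrite mulr0 lexx ler01.
  by apply/andP; split; nra.
by rewrite ler01 lexx.
Qed.

(* An unqualified [cdf] would be the library's, for random variables. *)
Lemma trade_seller_quantile {R : realType} (FS : probability R R)
    (x d t u : R) : (0 < d)%R -> (d < 1)%R -> (x <= 1)%R ->
  (forall y, (y < 1)%R -> Defs.cdf FS y <= x%:E) ->
  (forall a, (0 < a)%R -> (a <= x)%R -> a%:E <= Defs.cdf FS (d * a)%R) ->
  trade (quantile FS u) (seller_quantile x d t) 1 -> (t <= useful_quantile x u)%R.
Proof.
move=> d0 d1 x1 cdf_le cdf_ge /andP[p1 qp].
have tx : (t <= x)%R.
  rewrite leNgt; apply/negP => xt; move: qp.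
  by rewrite /seller_quantile (leNgt t x) xt/= => /le_lt_trans/(_ p1); rewrite ltxx.
rewrite /useful_quantile.
(* For u <= 0 the point 0 is admissible in the infimum, so the price is at most 0 and attracts only
   t <= 0. *)
have [u0|u0] /= := lerP u 0.
  rewrite leNgt; apply/negP => t0; move: qp; rewrite leNgt => /negP; apply.
  apply: (@le_lt_trans _ _ 0).
    apply: ereal_inf_lbound; exists 0%R => //=; split => //.
    by apply: (@le_trans _ _ 0) => //; rewrite ?lee_fin.
  by rewrite /seller_quantile tx lte_fin mulr_gt0// lt_max t0.
(* For 0 < u <= x the point d * u is admissible, so the price is at most d * u. *)
have [ux|xu] := lerP u x.
  have : (seller_quantile x d t)%:E <= (d * u)%:E.
    apply: le_trans qp _; apply: ereal_inf_lbound; exists (d * u)%R => //=.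
    by split; [rewrite mulr_ge0// ltW|exact: cdf_ge].
  rewrite /seller_quantile tx lee_fin ler_pM2l//; apply: le_trans.
  by rewrite le_max lexx.
(* For u > x no y < 1 is admissible, so the price is at least 1 and the buyer refuses. *)
move: p1; rewrite ltNge => /negP[]; apply: le_ereal_inf_tmp => _ [y [y0 uy] <-].
rewrite lee_fin leNgt; apply/negP => /cdf_le cx.
by have := le_trans uy cx; rewrite lee_fin leNgt xu.
Qed.

Lemma uniform_prob_itvNyc {R : realType} (a : R) : (0 <= a)%R -> (a <= 1)%R ->
  uniform_prob (@ltr01 R) `]-oo, a] = a%:E.
Proof.
move=> a0 a1; rewrite -[LHS]/(uniform_prob (@ltr01 R) `]-oo, a]%classic).
rewrite -[X in uniform_prob _ X]setIT -integral_indic//.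
rewrite integral_uniform//; last first.
  by apply/measurable_EFinP; exact: measurable_indic.
rewrite subr0 invr1 mul1e integral_indic//.
rewrite (_ : _ `&` _ = `[0%R, a]%classic); last first.
  apply/seteqP; split => t /=; rewrite !in_itv/=; first by move=> [-> /andP[->]].
  by move=> /andP[-> ta]; rewrite ta (le_trans ta a1).
apply: etrans (lebesgue_measure_itv _) _; rewrite /= lte_fin oppr0 adde0.
by case: ltgtP a0 => // <-.
Qed.

Definition seller_rv {R : realType} (x d : R) : {mfun measurableTypeR R >-> R} :=
  HB.pack_for {mfun measurableTypeR R >-> R} (seller_quantile x d)
    (@isMeasurableFun.Build _ _ (measurableTypeR R) R (seller_quantile x d)
       (measurable_seller_quantile x d)).

(** Inverse transform sampling: t is uniform on [0, 1], so expectations over the seller become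
    integrals over t. *)
Definition seller {R : realType} (x d : R) : probability R R :=
  distribution (uniform_prob (@ltr01 R)) (seller_rv x d).

(** A value below 1 forces t <= x, an event of probability x. *)
Lemma cdf_seller_le {R : realType} (x d y : R) : (0 <= x)%R -> (x <= 1)%R ->
  (y < 1)%R -> Defs.cdf (seller x d) y <= x%:E.
Proof.
move=> x0 x1 y1; rewrite -uniform_prob_itvNyc//.
apply: (@le_measure _ _ _ (uniform_prob (@ltr01 R))); rewrite ?inE//.
  rewrite -[X in measurable X]setTI.
  by apply: (measurable_seller_quantile x d) => //; exact: measurable_itv.
move=> t /=; rewrite !in_itv/= /seller_quantile; case: ifP => // _.
by rewrite leNgt y1.
Qed.

(** Every t <= a has value at most d * a. *)
Lemma cdf_seller_ge {R : realType} (x d a : R) : (x <= 1)%R -> (0 < d)%R ->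
  (0 < a)%R -> (a <= x)%R -> a%:E <= Defs.cdf (seller x d) (d * a)%R.
Proof.
move=> x1 d0 a0 ax; rewrite -(@uniform_prob_itvNyc _ a) ?(ltW a0) ?(le_trans ax)//.
apply: (@le_measure _ _ _ (uniform_prob (@ltr01 R))); rewrite ?inE//.
  rewrite -[X in measurable X]setTI.
  by apply: (measurable_seller_quantile x d) => //; exact: measurable_itv.
move=> t /=; rewrite !in_itv/= /seller_quantile => ta.
by rewrite (le_trans ta ax) ler_pM2l// ge_max ta ltW.
Qed.

Lemma nonneg_L1_seller {R : realType} (x d : R) : (0 < d)%R -> (d < 1)%R ->
  (x <= 1)%R -> nonneg_L1 (seller x d).
Proof.
move=> d0 d1 x1; have q01 t := seller_quantile_itv x d t d0 d1 x1.
split.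
  rewrite /seller /distribution /pushforward /=.
  rewrite (_ : _ @^-1` _ = set0) ?measure0//.
  rewrite -subset0 => t /=; rewrite in_itv/= ltNge.
  by case/andP: (q01 t) => ->.
apply/integrableP; split; first exact/measurable_EFinP.
rewrite integral_distribution_measurable; last first.
  by apply: measurableT_comp => //; exact/measurable_EFinP.
apply: (@le_lt_trans _ _ (\int[uniform_prob (@ltr01 R)]_t cst 1 t)).
  apply: le_integral_ge0r => // t /=; rewrite lee_fin.
  by case/andP: (q01 t) => q0 q1; rewrite ger0_norm.
rewrite integral_cst// mul1e; apply: le_lt_trans (ltry 1).
exact: probability_le1.
Qed.

Lemma nonneg_L1_dirac {R : realType} (b : R) : (0 <= b)%R ->
  nonneg_L1 (dirac b : probability R R).
Proof.
move=> b0; split.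
  by rewrite /= /dirac indicE memNset//= in_itv/= ltNge b0.
apply/integrableP; split; first exact/measurable_EFinP.
rewrite integral_dirac//; last by apply: measurableT_comp => //; exact/measurable_EFinP.
by rewrite diracT mul1e ltry.
Qed.

(** * Welfare bounds for this seller and a buyer of value 1 *)

Lemma OPTW_seller_ge1 {R : realType} (x d : R) :
  1 <= OPTW (seller x d) (dirac (1%R : R)).
Proof.
rewrite /OPTW integral_prod_dirac; last first.
  by apply/measurable_EFinP; apply: measurable_maxr.
rewrite integral_distribution_measurable; last first.
  apply/measurable_EFinP; apply: measurable_maxr => //.
  exact: measurable_id.
apply: (@le_trans _ _ (\int[uniform_prob (@ltr01 R)]_t cst 1 t)).
  rewrite integral_cst// mul1e.
  by rewrite -[X in _ <= X]/(uniform_prob (@ltr01 R) setT) probability_setT.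
by apply: le_integral_ge0r => t /=; rewrite lee_fin le_max ?ler01 ?lexx.
Qed.

Lemma W_seller_le {R : realType} (x d u : R) : (0 < d)%R -> (d < 1)%R ->
  (0 <= x)%R -> (x <= 1)%R ->
  W (seller x d) (dirac (1%R : R)) (quantile (seller x d) u) <=
  (d + (1 - x))%:E + (useful_quantile x u)%:E.
Proof.
move=> d0 d1 x0 x1; set p := quantile _ _; set v := useful_quantile x u.
have v0 : (0 <= v)%R by exact: useful_quantile_ge0.
have v1 : (v <= 1)%R.
  by rewrite /v /useful_quantile; case: ifP => // /andP[_ ux]; exact: le_trans x1.
have vp t : trade p (seller_quantile x d t) 1 -> (t <= v)%R.
  apply: trade_seller_quantile => //; first by move=> y; exact: cdf_seller_le.
  by move=> a; exact: cdf_seller_ge.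
rewrite /W integral_prod_dirac; last exact: measurable_welfare.
rewrite integral_distribution_measurable; last first.
  exact: (measurable_fun_pair1 _ (measurable_welfare _ p)).
(* A trade yields welfare 1 and needs t <= v. Without trade the seller keeps at most d if t <= x,
   and 1 if t > x. *)
pose g t := d%:E + (\1_(~` `]-oo, x]) t : R)%:E + (\1_(`]-oo, v]) t : R)%:E.
apply: (@le_trans _ _ (\int[uniform_prob (@ltr01 R)]_t g t)).
  apply: le_integral_ge0r => t /=; rewrite /g -!EFinD lee_fin; last first.
    by rewrite !addr_ge0// ltW.
  have [ptrade|notrade] := boolP (trade p (seller_quantile x d t) 1).
    rewrite mulr1 [leLHS]addrC subrK [X in (_ + X)%R]indicE mem_set/=; last first.
      by rewrite in_itv/= vp.
    by rewrite lerDr addr_ge0// ltW.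
  rewrite mulr0 addr0 -[leLHS]addr0 lerD// /seller_quantile.
  rewrite indicE in_setC; case: ifPn => [tx|tx].
    rewrite mem_set/= ?in_itv//= addr0 ger_pMr// ge_max ler01 andbT.
    exact: le_trans x1.
  by rewrite memNset/= ?in_itv/= ?(negbTE tx)// lerDr ltW.
rewrite /g ge0_integralD//; last 3 first.
- by move=> t _; rewrite adde_ge0 ?lee_fin// ltW.
- apply: emeasurable_funD => //; apply/measurable_EFinP.
  by apply: measurable_indic; exact: measurableC.
- by apply/measurable_EFinP; exact: measurable_indic.
rewrite ge0_integralD//; last 2 first.
- by move=> t _; rewrite lee_fin ltW.
- apply/measurable_EFinP.
  by apply: measurable_indic; exact: measurableC.
rewrite integral_cst// !integral_indic//; last exact: measurableC.
rewrite !setIT -addeA.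
have unifC : uniform_prob (@ltr01 R) (~` `]-oo, x]) = (1 - x)%:E.
  rewrite (probability_setC (uniform_prob (@ltr01 R)))//.
  by rewrite EFinB; congr (_ - _); exact: uniform_prob_itvNyc.
rewrite [leLHS](_ : _ = d%:E * 1 + ((1 - x)%:E + v%:E)).
  by rewrite mule1 addeA.
congr (_ * _ + (_ + _)); [exact: probability_setT|exact: unifC|].
exact: uniform_prob_itvNyc.
Qed.

(** * Choice of the instance for given [G] and [eps] *)

Theorem theorem14 (R : realType) (G : probability R R)
  (hG : G (~` `[(0:R)%R, (1:R)%R]%classic) = 0) (eps : R) (heps : (0 < eps)%R) :
  exists FS FB : probability R R,
    [/\ nonneg_L1 FS, nonneg_L1 FB, 0 < OPTW FS FB &
        WG G FS FB <= ((1 - expR (-1)) + eps)%R%:E * OPTW FS FB].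
Proof.
have [x [x0 x1 Gx]] : exists x : R, [/\ (0 < x)%R, (x <= 1)%R &
    \int[G]_u (useful_quantile x u)%:E <= (x - expR (- (1 + eps / 2)))%:E].
  by apply: exists_low_threshold; rewrite ltrDl divr_gt0.
(* Half of [eps] pays for [d], the other half for replacing exp(-1) by exp(-(1 + eps / 2)). The
   bound 1 / 2 keeps d < 1. *)
pose d := (Num.min (eps / 2) (1 / 2))%R.
have d0 : (0 < d)%R by rewrite lt_min; apply/andP; split; lra.
have d1 : (d < 1)%R by rewrite gt_min; apply/orP; right; lra.
have de : (d <= eps / 2)%R by rewrite ge_min lexx.
exists (seller x d), (dirac (1%R : R)).
have OPT1 := OPTW_seller_ge1 x d.
split.
- exact: nonneg_L1_seller.
- exact: nonneg_L1_dirac.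
- exact: lt_le_trans OPT1.
have e1 : (expR (-1) <= 1 :> R)%R by rewrite -[leRHS]expR0 ler_expR; lra.
have c0 : (0 <= 1 - expR (-1) + eps)%R by lra.
have eL : (expR (-1) - eps / 2 <= expR (- (1 + eps / 2)))%R.
  have e2 : (1 - eps / 2 <= expR (- (eps / 2)))%R by exact: expR_ge1Dx.
  have := expR_gt0 (-1 : R)%R.
  by rewrite opprD expRD; nra.
(* The factor is nonnegative and the optimum at least 1, so bounding the mechanism's welfare by the
   factor alone suffices. *)
apply: (@le_trans _ _ (1 - expR (-1) + eps)%:E); last first.
  by rewrite -[leLHS]mule1 lee_wpmul2l// lee_fin.
apply: (@le_trans _ _ (\int[G]_u ((d + (1 - x))%:E + (useful_quantile x u)%:E))).
  apply: le_integral_ge0r => u; first by apply: W_seller_le => //; exact: ltW.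
  by rewrite -EFinD lee_fin addr_ge0 ?useful_quantile_ge0// addr_ge0 ?subr_ge0// ltW.
rewrite ge0_integralD//; last 3 first.
- by move=> u _; rewrite lee_fin addr_ge0 ?subr_ge0// ltW.
- by move=> u _; rewrite lee_fin useful_quantile_ge0.
- by apply/measurable_EFinP; exact: measurable_useful_quantile.
rewrite integral_cst//.
(* The threshold x cancels, leaving d + 1 - exp(-(1 + eps / 2)). *)
apply: (@le_trans _ _ ((d + (1 - x))%:E + (x - expR (- (1 + eps / 2)))%:E)).
  apply: leeD Gx; rewrite -[leRHS]mule1 lee_wpmul2l//.
    by rewrite lee_fin addr_ge0 ?subr_ge0// ltW.
  exact: probability_le1.
by rewrite -EFinD lee_fin; lra.
Qed.
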